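(* Let $\mathcal{H}$ be a real Hilbert space and let $\mathcal{C}\subset\mathcal{H}$ be a perfect cone. Let $f:\mathcal{C}\to(-\infty,\infty]$ be proper. Then $f=f^{**}$ if and only if $f\in\Gamma_\nearrow(\mathcal{C})$.
   Context: $\mathcal{H}$ has inner product $\langle\cdot,\cdot\rangle$. A cone is a subset $\mathcal{C}\subset\mathcal{H}$ that is convex and contains the origin, i.e. $\alpha x+\beta y\in\mathcal{C}$ for all $x,y\in\mathcal{C}$ and $\alpha,\beta\ge 0$. It is pointed if $\mathcal{C}\cap(-\mathcal{C})=\{0\}$. Write $x\preceq y$ (equivalently $y\succeq x$) if $y-x\in\mathcal{C}$. $\overline{\mathrm{span}}$ denotes the closed linear span. The dual cone of a cone $\mathcal{K}$ is taken within its closed linear span: $\mathcal{K}^\vee=\{x\in\overline{\mathrm{span}}\,\mathcal{K}:\langle x,y\rangle\ge 0\ \forall y\in\mathcal{K}\}$. A face of a closed and pointed cone $\mathcal{C}$ is a subset $\mathcal{F}\subset\mathcal{C}$ which is a cone and satisfies: if $0\preceq x\preceq y$ and $y\in\mathcal{F}$, then $x\in\mathcal{F}$. A (closed and pointed) cone $\mathcal{C}$ is perfect if every face $\mathcal{F}$ of $\mathcal{C}$ satisfies: (1) $\mathcal{F}^\vee=\mathcal{F}$; (2) $\mathcal{F}$ has nonempty interior with respect to $\overline{\mathrm{span}}\,\mathcal{F}$. For $f:\mathcal{C}\to(-\infty,\infty]$: the monotone conjugate is $f^*(y)=\sup_{z\in\mathcal{C}}\{\langle z,y\rangle-f(z)\}$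 for $y\in\mathcal{C}^\vee$, and the monotone biconjugate is $f^{**}(x)=\sup_{y\in\mathcal{C}^\vee}\{\langle y,x\rangle-f^*(y)\}$ for $x\in\mathcal{C}$. $f$ is proper if it is not identically $\infty$. $f$ is $\mathcal{C}$-nondecreasing if $f(x)\ge f(y)$ whenever $x\succeq y\succeq 0$. $\Gamma_\nearrow(\mathcal{C})$ is the set of functions $\mathcal{C}\to(-\infty,\infty]$ that are proper, convex, lower semicontinuous and $\mathcal{C}$-nondecreasing. *)

(* Defs.v *)
From HB Require Import structures.
From mathcomp Require Import all_boot all_order all_algebra.
From mathcomp Require Import all_classical all_reals all_analysis.

Set Implicit Arguments.
Unset Strict Implicit.
Unset Printing Implicit Defensive.

Import Order.TTheory GRing.Theory Num.Theory.
Import numFieldNormedType.Exports.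

Local Open Scope classical_set_scope.
Local Open Scope ring_scope.

(* A real Hilbert space is a complete normed module over a realType together
   with a positive definite symmetric bilinear form inducing its norm. *)
Definition hilbert_inner (R : realType) (H : completeNormedModType R)
    (ip : {dot H for idfun}) : Prop :=
  forall x : H, ip x x = `|x| ^+ 2.

Section Cones.
Context (R : realType) (H : completeNormedModType R).
Variable ip : {dot H for idfun}.
Implicit Types (C F K : set H) (x y : H).

Definition is_cone C : Prop :=
  C 0 /\ forall (a b : R) x y, 0 <= a -> 0 <= b -> C x -> C y ->
    C (a *: x + b *: y).

Definition pointed_cone C : Prop := C `&` [set - x | x in C] = [set 0].

Definition cone_le C x y : Prop := C (y - x).

Definition lin_span (A : set H) : set H :=
  [set x | exists n (a : 'I_n -> R) (v : 'I_n -> H),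
     (forall i, A (v i)) /\ x = \sum_(i < n) a i *: v i].

Definition closed_span (A : set H) : set H := closure (lin_span A).

Definition dual_cone K : set H :=
  [set x | closed_span K x /\ forall y, K y -> 0 <= ip x y].

Definition is_face C F : Prop :=
  [/\ F `<=` C, is_cone F &
      forall x y, cone_le C 0 x -> cone_le C x y -> F y -> F x].

(* Points outside A are isolated in the topology of [subspace A]; since F is
   contained in its closed span, the interior below is the interior of F
   relative to that span. *)
Definition has_relative_interior F : Prop :=
  interior (F : set (subspace (closed_span F))) !=set0.

Definition perfect_cone C : Prop :=
  [/\ is_cone C, closed C, pointed_cone C &
      forall F, is_face C F -> dual_cone F = F /\ has_relative_interior F].

(* A function C -> (-oo, +oo] is represented by a total f : H -> \bar R of
   which only the values on C are ever used; [into_ninfty_free C f] says that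
   these values lie in (-oo, +oo]. *)
Implicit Types f : H -> \bar R.

Definition into_ninfty_free C f : Prop := forall x, C x -> (-oo < f x)%E.

Definition monotone_conjugate C f : H -> \bar R :=
  fun y => ereal_sup [set ((ip z y)%:E - f z)%E | z in C].

Definition monotone_biconjugate C f : H -> \bar R :=
  fun x => ereal_sup
    [set ((ip y x)%:E - monotone_conjugate C f y)%E | y in dual_cone C].

Definition proper_on C f : Prop := exists2 x, C x & f x <> +oo%E.

Definition cone_nondecreasing C f : Prop :=
  forall x y, cone_le C y x -> cone_le C 0 y -> (f y <= f x)%E.

(* The library's convex_function is restricted to real-valued functions.  At
   t = 0 and t = 1 the convention 0 * +oo = 0 makes the inequality trivial. *)
Definition convex_on C f : Prop :=
  forall (t : R) x y, 0 <= t <= 1 -> C x -> C y ->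
    (f (t *: x + (1 - t) *: y)%R <= t%:E * f x + (1 - t)%:E * f y)%E.

(* Lower semicontinuity for the relative topology of C; it is vacuous at the
   points outside C, which are isolated in [subspace C]. *)
Definition lsc_on C f : Prop := lower_semicontinuous (from_subspace C f).

Definition Gamma_nondecr C f : Prop :=
  [/\ into_ninfty_free C f, proper_on C f, convex_on C f, lsc_on C f &
      cone_nondecreasing C f].

End Cones.

(* Main.v *)
Require Import Defs.
From mathcomp Require Import all_boot all_order all_algebra.
From mathcomp Require Import all_classical all_reals all_analysis.
From mathcomp Require Import ring lra.

(** A biconjugate is a supremum of affine functions [ip y x - b] with slopes
    [y] in the dual cone, which is [C] itself because [C] is one of its own
    faces. Such suprema are convex, lower semicontinuous and nondecreasing,
    which gives one direction.

    Conversely, let [f] be convex, lower semicontinuous and nondecreasing, let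
    [x] be in [C] and [a < f x]. It suffices to find an affine minorant of [f]
    with slope in [C] whose value at [x] is at least [a]
    ([affine_minorant_above]). Monotonicity makes the effective domain of [f]
    an order ideal, so the cone [F] that it generates is a face of [C]
    ([domain_cone_face]), and perfectness may be applied to [F].

    If [x] is not in [F], there is [y] in [C] orthogonal to [F] with
    [0 < ip y x], since faces of a perfect cone are cut out by such [y]
    ([separation_from_face]). The constant [f 0] bounds [f] from below, and
    [f 0 + t * ip y z] is still a minorant for every [t >= 0]; its value at [x]
    is as large as desired.

    If [x] is in [F], the point [(x, a)] is separated from the set of all
    [(c - u, r)] with [f c <= r] and [u] in [F]. Letting [F] be subtracted
    forces the separating slope to be nonnegative on [F]; it also lies in the
    closed span of [F], hence in the dual of [F], which is [F]. The separation
    is strict because [(x, a)] stays at a positive distance from this set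
    ([epigraph_gap]), and here the interior point of [F] is needed: it absorbs
    the small error in [c - u = x + error], so that a point of [F] close to [x]
    lies below a point close to [c], where monotonicity and lower
    semicontinuity apply. If the separating hyperplane is vertical, it is
    again added with a large factor to the constant minorant [f 0]
    ([affine_minorant_steepen]).

    All separations come from the point of least norm of the closure of a
    convex subset of [H * R] ([separation_from_zero]). *)

Set Implicit Arguments.
Unset Strict Implicit.
Unset Printing Implicit Defensive.

Import Order.TTheory GRing.Theory Num.Theory.
Import numFieldNormedType.Exports.

Local Open Scope classical_set_scope.
Local Open Scope ring_scope.

(** * Separation in a Hilbert space *)

Lemma ge0_of_small_perturbations (R : realFieldType) (a K : R) :
  (forall t, 0 < t <= 1 -> 0 <= a + t * K) -> 0 <= a.
Proof.
move=> h; rewrite leNgt; apply/negP => a0.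
pose M := `|K| + 1 - a.
have M1 : 0 < M by rewrite /M; have := normr_ge0 K; lra.
have Kle : K <= `|K| := ler_norm K.
have t0 : 0 < - a / M by rewrite divr_gt0 ?oppr_gt0.
have t1 : - a / M <= 1.
  by rewrite ler_pdivrMr // mul1r /M; have := normr_ge0 K; lra.
have := h (- a / M); rewrite t0 t1 => /(_ isT).
have -> : a + - a / M * K = - a / M * (K - M).
  by field; rewrite gt_eqF.
rewrite pmulr_rge0 // /M; lra.
Qed.

(** Used along the rays of a cone: a functional bounded below on a ray is
    nonnegative in its direction. *)
Lemma slope_ge0 (R : realFieldType) (a b c : R) :
  (forall t, 0 <= t -> c <= t * a + b) -> 0 <= a.
Proof.
move=> h; apply: (@ge0_of_small_perturbations _ _ (b - c)) => t /andP[t0 _].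
have := h t^-1; rewrite invr_ge0 (ltW t0) => /(_ isT).
by rewrite -(ler_pM2l t0) mulrDr mulVKf ?gt_eqF //; lra.
Qed.

Section HilbertSpace.
Context (R : realType) (H : completeNormedModType R) (ip : {dot H for idfun}).
Hypothesis hH : hilbert_inner ip.
Implicit Types (x y z w : H) (a b r s t : R).

Lemma ipC x y : ip x y = ip y x.
Proof. by rewrite hermC expr0 mul1r. Qed.

Lemma ipDl x y z : ip (x + y) z = ip x z + ip y z.
Proof. exact: linearDl. Qed.

Lemma ipZl a x z : ip (a *: x) z = a * ip x z.
Proof. exact: linearZl_LR. Qed.

Lemma ipDr x y z : ip z (x + y) = ip z x + ip z y.
Proof. exact: linearDr. Qed.

Lemma ipZr a x z : ip z (a *: x) = a * ip z x.
Proof. exact: linearZr_LR. Qed.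

Lemma ipNl x z : ip (- x) z = - ip x z.
Proof. by rewrite -scaleN1r ipZl mulN1r. Qed.

Lemma ipNr x z : ip z (- x) = - ip z x.
Proof. by rewrite -scaleN1r ipZr mulN1r. Qed.

Lemma ip0r z : ip z 0 = 0.
Proof. by rewrite -(scale0r 0) ipZr mul0r. Qed.

Lemma ip0l z : ip 0 z = 0.
Proof. by rewrite ipC ip0r. Qed.

Definition ipE := (ipDl, ipDr, ipNl, ipNr, ipZl, ipZr).

(** Reduces identities between linear combinations of vectors to [ring]
    identities between scalars. *)
Lemma ip_injl x y : (forall z, ip x z = ip y z) -> x = y.
Proof.
move=> xy; apply/eqP; rewrite -subr_eq0 -normr_eq0 -sqrf_eq0 -hH.
by rewrite ipDl ipNl xy subrr.
Qed.

Lemma cauchy_schwarz x y : `|ip x y| <= `|x| * `|y|.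
Proof.
have [->|x0] := eqVneq x 0; first by rewrite ip0l !normr0 mul0r.
have [->|y0] := eqVneq y 0; first by rewrite ip0r !normr0 mulr0.
have nx : 0 < `|x| by rewrite normr_gt0.
have ny : 0 < `|y| by rewrite normr_gt0.
have P : 0 < `|x| * `|y| by rewrite mulr_gt0.
have key e : e * e = 1 -> 0 <= `|x| * `|y| + e * ip x y.
  move=> e2.
  have : 0 <= ip (`|y| *: x + (e * `|x|) *: y) (`|y| *: x + (e * `|x|) *: y).
    by rewrite hH sqr_ge0.
  rewrite !ipE (ipC y x) !hH.
  rewrite [X in 0 <= X](_ : _ = (`|x| * `|y|) *
     ((1 + e * e) * (`|x| * `|y|) + 2 * (e * ip x y))); last by ring.
  rewrite e2 pmulr_rge0 //; lra.
have h1 := key 1 (mulr1 _).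
have h2 := key (-1) (etrans (mulrNN _ _) (mulr1 _)).
rewrite ler_norml; lra.
Qed.

(** The minimizing sequence of [`|z| ^+ 2 + r ^+ 2] on [A] is Cauchy by the
    parallelogram identity. Its limit [(w, s)] need not lie in [A], but the
    variational inequality of the minimum passes to the limit. Working in
    [H * R] allows [A] to be a translated epigraph, and [w] is located only by
    its being a limit of first components. *)
Lemma separation_from_zero (A : set (H * R)) (d : R) :
    A !=set0 ->
    (forall z r z' r' t, 0 <= t <= 1 -> A (z, r) -> A (z', r') ->
      A (t *: z + (1 - t) *: z', t * r + (1 - t) * r')) ->
    0 < d -> (forall z r, A (z, r) -> d <= `|z| ^+ 2 + r ^+ 2) ->
  exists w s q, [/\ 0 < q, forall z r, A (z, r) -> q <= ip w z + s * r &
    closure (fst @` A) w].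
Proof.
move=> [[z0 r0] A0] Acvx d0 Ad.
pose N (p : H * R) : R := `|p.1| ^+ 2 + p.2 ^+ 2.
pose S : set R := [set N p | p in A].
have S0 : has_inf S.
  split; first by exists (N (z0, r0)), (z0, r0).
  by exists d => _ [[z r] /Ad h <-].
pose q := inf S.
have qle z r : A (z, r) -> q <= `|z| ^+ 2 + r ^+ 2.
  by move=> Azr; apply: (inf_lbound S0.2); exists (z, r).
have dq : d <= q.
  apply: lb_le_inf; first exact: S0.1.
  by move=> _ [[z r] /Ad h <-].
have /choice[p pP] : forall n : nat, exists p : H * R,
    A p /\ N p < q + n.+1%:R^-1.
  move=> n; have e0 : (0 : R) < n.+1%:R^-1 by rewrite invr_gt0.
  by have [_ [p Ap <-] lt] := inf_adherent e0 S0; exists p.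
pose z n := (p n).1; pose r n := (p n).2.
have pA n : A (z n, r n) by rewrite -surjective_pairing; exact: (pP n).1.
have pN n : `|z n| ^+ 2 + r n ^+ 2 < q + n.+1%:R^-1 := (pP n).2.
(* Parallelogram identity, with the midpoint kept inside [A] by convexity. *)
have para n m : `|z n - z m| ^+ 2 + (r n - r m) ^+ 2 <
    2 * (n.+1%:R^-1 + m.+1%:R^-1).
  have h2 : 0 <= (2^-1 : R) <= 1 by rewrite invr_ge0 ler0n invf_le1 ?ler1n.
  have := qle _ _ (Acvx _ _ _ _ _ h2 (pA n) (pA m)).
  have := pN n; have := pN m.
  rewrite -!hH !ipE (ipC (z m) (z n)).
  have -> : 1 - 2^-1 = 2^-1 :> R by field.
  move: (ip (z n) (z n)) (ip (z n) (z m)) (ip (z m) (z m)) => a b c.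
  by move: (n.+1%:R^-1) (m.+1%:R^-1) => u v; lra.
have quarter (a b c : R) : a < c / 4 -> b < c / 4 -> 2 * (a + b) < c by lra.
have cauchy_of (V : completeNormedModType R) (u : nat -> V) :
    (forall n m, `|u n - u m| ^+ 2 < 2 * (n.+1%:R^-1 + m.+1%:R^-1)) ->
    cvg (u @ \oo).
  move=> hu; apply/cauchy_cvgP/cauchy_ballP => e e0.
  have e4 : 0 < e ^+ 2 / 4 by rewrite divr_gt0 // exprn_gt0.
  have hS := near_infty_natSinv_lt (PosNum e4).
  pose S' : set nat := [set n | n.+1%:R^-1 < e ^+ 2 / 4].
  exists (u @` S', u @` S').
    by split; apply: filterS hS => n hn; exists n.
  move=> [_ _] /= [[n hn <-] [m hm <-]]; rewrite -ball_normE /=.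
  rewrite /S' /= in hn hm.
  rewrite -(@ltr_pXn2r _ 2) ?nnegrE ?normr_ge0 ?(ltW e0) //.
  apply: (lt_trans (hu n m)). exact: quarter.
have zc : cvg (z @ \oo).
  apply: cauchy_of => n m; apply: le_lt_trans (para n m).
  by rewrite lerDl sqr_ge0.
have rc : cvg (r @ \oo).
  apply: (cauchy_of R^o) => n m; rewrite real_normK ?num_real //.
  by apply: le_lt_trans (para n m); rewrite lerDr sqr_ge0.
set w := lim (z @ \oo) in zc; set s := lim (r @ \oo) in rc.
have close e : 0 < e -> exists n,
    [/\ `|z n - w| < e, `|r n - s| < e & n.+1%:R^-1 < e].
  move=> e0.
  have hz : \forall n \near \oo, `|z n - w| < e.
    by apply: cvgr_distC_lt zc _ e0.
  have hr : \forall n \near \oo, `|r n - s| < e.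
    by apply: (@cvgr_distC_lt _ R^o _ _ _ _ _ rc _ e0).
  have hS := near_infty_natSinv_lt (PosNum e0).
  have [n [[nz nr] ne]] := filter_ex (filterI (filterI hz hr) hS).
  by exists n.
exists w, s, q; split; first exact: lt_le_trans dq.
  move=> v a Av.
  (* For [p_n = (z n, r n)] within [t ^+ 2] of the infimum and of the limit,
     minimality along the segment from [p_n] to [(v, a)] gives the inequality
     up to an error of order [t]; [M] bounds the squared length of the segment
     and [K] the effect of replacing [p_n] by [(w, s)]. *)
  pose M := 2 * (`|v| ^+ 2 + a ^+ 2) + 2 * (q + 1).
  pose K := `|v| + `|a|.
  suff : 0 <= (ip w v + s * a) - q by rewrite subr_ge0.
  apply: (@ge0_of_small_perturbations _ _ (1 + M + K)) => t t01.
  have t2 : 0 < t ^+ 2 by rewrite exprn_gt0; case/andP: t01.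
  have [n [nz nr ne]] := close _ t2.
  have tt : 0 <= t <= 1 by case/andP: t01 => /ltW -> ->.
  have h1 := qle _ _ (Acvx _ _ _ _ _ tt Av (pA n)).
  have h2 := pN n.
  have h3 : `|ip (z n - w) v| <= t ^+ 2 * `|v|.
    by apply: (le_trans (cauchy_schwarz _ _)); rewrite ler_wpM2r // ltW.
  have h4 : `|(r n - s) * a| <= t ^+ 2 * `|a|.
    by rewrite normrM ler_wpM2r // ltW.
  have h5 := qle _ _ (pA n).
  have h6 : 0 <= `|v + z n| ^+ 2 by rewrite sqr_ge0.
  rewrite -!hH !ipE in h1 h2 h3 h5 h6.
  rewrite (ipC (z n) v) in h1 h3 h6.
  have [t0 t1] := andP t01.
  have tle : t ^+ 2 <= t by rewrite expr2 ger_pMr.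
  have h7 : t ^+ 2 * K <= t * K by rewrite ler_wpM2r // addr_ge0.
  have h8 : n.+1%:R^-1 <= 1 :> R by rewrite invf_le1 ?ler1n.
  have h9 : 0 <= (a + r n) ^+ 2 by rewrite sqr_ge0.
  rewrite /M -hH.
  have h10 : 0 <= t * (t * (1 + M) + 2 * (ip v (z n) + a * r n - q)).
    rewrite /M -hH.
    set vz := ip v (z n) in h1 h3 h6 *.
    set zz := ip (z n) (z n) in h1 h2 h5 h6 *.
    set vv := ip v v in h1 h6 *.
    set e := n.+1%:R^-1 in ne h2 h8.
    set rn := r n in h1 h2 h5 h9 *.
    have hB : vv - 2 * vz + zz + (a - rn) ^+ 2 <=
        2 * (vv + a ^+ 2) + 2 * (q + 1) by lra.
    have hB' := ler_wpM2l (ltW t2) hB.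
    have hq : t * q <= t * (zz + rn ^+ 2) by rewrite ler_wpM2l // ltW.
    lra.
  rewrite pmulr_rge0 // in h10.
  have M0 : 0 <= M.
    have q0 : 0 <= q by rewrite (le_trans (ltW d0)).
    have := sqr_ge0 `|v|; have := sqr_ge0 a.
    by rewrite /M; lra.
  have h11 : 0 <= t * (1 + M) by exact: mulr_ge0 (ltW t0) (addr_ge0 ler01 M0).
  move: h3 h4 h7 h10 h11; rewrite !ler_norml /M /K -hH.
  by move=> /andP[_ ?] /andP[_ ?] ? ? ?; lra.
move=> B /nbhs_ballP[e /= e0 eB].
have [n [nz _ _]] := close e e0.
exists (z n); split; first by exists (z n, r n).
by apply: eB; rewrite -ball_normE /= distrC.
Qed.
End HilbertSpace.

(** * Cones and their faces *)

Section Spans.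
Context (R : realType) (H : completeNormedModType R).
Implicit Types (A F : set H) (x y : H) (a b : R).

Lemma lin_span_sub A x : A x -> lin_span A x.
Proof.
move=> Ax; exists 1, (fun=> 1), (fun=> x); split=> //.
by rewrite big_ord1 scale1r.
Qed.

Lemma lin_spanD A x y : lin_span A x -> lin_span A y -> lin_span A (x + y).
Proof.
move=> [n [a [u [Au ->]]]] [m [b [v [Av ->]]]].
exists (n + m)%N,
  (fun i : 'I_(n + m) =>
     match fintype.split i with inl j => a j | inr j => b j end),
  (fun i : 'I_(n + m) =>
     match fintype.split i with inl j => u j | inr j => v j end); split.
  by move=> i; case: (fintype.split i).
rewrite big_split_ord /=; congr (_ + _); apply: eq_bigr => i _.
  by rewrite (unsplitK (inl i)).
by rewrite (unsplitK (inr i)).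
Qed.

Lemma lin_spanZ A a x : lin_span A x -> lin_span A (a *: x).
Proof.
move=> [n [b [u [Au ->]]]]; exists n, (fun i => a * b i), u; split=> //.
by rewrite scaler_sumr; apply: eq_bigr => i _; rewrite scalerA.
Qed.

Lemma lin_spanB A x y : lin_span A x -> lin_span A y -> lin_span A (x - y).
Proof. by move=> Ax Ay; rewrite -scaleN1r; apply/lin_spanD/lin_spanZ. Qed.

Lemma closed_span_sub A x : lin_span A x -> closed_span A x.
Proof. exact: subset_closure. Qed.

Lemma closure_lin_span A (B : set H) x :
  B `<=` lin_span A -> closure B x -> closed_span A x.
Proof. by move=> BA; exact: closureS. Qed.

Lemma coneD F x y : is_cone F -> F x -> F y -> F (x + y).
Proof.
by move=> [_ h] Fx Fy; have := h 1 1 x y ler01 ler01 Fx Fy; rewrite !scale1r.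
Qed.

Lemma coneZ F a x : is_cone F -> 0 <= a -> F x -> F (a *: x).
Proof.
by move=> [_ h] a0 Fx; have := h a 0 x x a0 (lexx _) Fx Fx; rewrite scale0r addr0.
Qed.

End Spans.

Section Faces.
Context (R : realType) (H : completeNormedModType R) (ip : {dot H for idfun}).
Hypothesis hH : hilbert_inner ip.
Context (C : set H).
Hypothesis hC : perfect_cone ip C.
Implicit Types (F G : set H) (x y : H) (a b : R).

Lemma perfect_is_cone : is_cone C.
Proof. by case: hC. Qed.
Let cC := perfect_is_cone.

Lemma perfect_is_face : is_face C C.
Proof. by split=> // x y; rewrite /cone_le subr0. Qed.

Lemma face_le F x y : is_face C F -> C x -> C (y - x) -> F y -> F x.
Proof. by move=> [_ _ h] Cx Cyx; apply: h => //; rewrite /cone_le subr0. Qed.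

Lemma face_dual F : is_face C F -> dual_cone ip F = F.
Proof. by case: hC => _ _ _ h /h[]. Qed.

Lemma face_ip_ge0 F x y : is_face C F -> F x -> F y -> 0 <= ip x y.
Proof. by move=> fF; rewrite -{1}(face_dual fF) => -[_ h] /h. Qed.

Lemma face_interior_ball F : is_face C F ->
  exists e (r : R), [/\ F e, 0 < r &
    forall v, lin_span F v -> `|v| < r -> F (e + v)].
Proof.
move=> fF; have [_ [e]] : dual_cone ip F = F /\ has_relative_interior F.
  by case: hC => _ _ _; apply.
rewrite /interior /= => eF.
have Fe : F e by exact: nbhs_singleton eF.
have se : closed_span F e by exact/closed_span_sub/lin_span_sub.
have [V /nbhs_ballP[r /= r0 rV] FV] := (nbhs_subspace_ex F se).1 eF.
exists e, r; split=> // v sv vr.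
suff : (F `&` closed_span F) (e + v) by case.
rewrite FV; split; first apply: rV.
  by rewrite -ball_normE /= opprD addNKr normrN.
by apply: closed_span_sub; apply: lin_spanD => //; exact: lin_span_sub.
Qed.

(** Faces are exposed, in the sense that [F] is the intersection of [C] with
    the hyperplanes orthogonal to the vectors of [C] that are orthogonal to
    [F]. That intersection [G] is a face, and it suffices that [F] contain an
    interior point [e] of [G]. Otherwise [- e] is at a positive distance from
    [G - F]: an element of [F] close to [g + e], with [g] in [G], dominates
    [2^-1 *: e], so that [e] would be in [F]. Separating [- e] from [G - F] gives a vector [w] of the dual
    of [G], hence of [G], which vanishes on [F]; then [w] is orthogonal to
    itself by the definition of [G]. *)
Lemma separation_from_face F x : is_face C F -> C x -> ~ F x ->
  exists y, [/\ C y, forall z, F z -> ip y z = 0 & 0 < ip y x].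
Proof.
move=> fF Cx nFx.
have [FC cF _] := fF.
pose G : set H := [set z | C z /\
  forall y, C y -> (forall v, F v -> ip y v = 0) -> ip y z = 0].
have FG : F `<=` G by move=> z Fz; split=> [|y _]; [exact: FC|exact].
have fG : is_face C G.
  split; first by move=> z [].
    split; first by exact/FG/cF.1.
    move=> a b u v a0 b0 [Cu uG] [Cv vG]; split; first exact: cC.2.
    by move=> y Cy Fy; rewrite ipDr !ipZr uG // vG // !mulr0 addr0.
  move=> u v; rewrite /cone_le subr0 => Cu Cvu [Cv vG]; split=> // y Cy Fy.
  apply/eqP; rewrite eq_le (face_ip_ge0 perfect_is_face) // andbT.
  have := face_ip_ge0 perfect_is_face Cy Cvu.
  by rewrite ipDr ipNr vG // sub0r oppr_ge0.
suff GF : G `<=` F.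
  apply: contrapT => ny; apply/nFx/GF; split=> // y Cy Fy.
  apply: contrapT => /eqP yx; apply: ny; exists y; split=> //.
  by rewrite lt_neqAle eq_sym yx (face_ip_ge0 perfect_is_face).
have [cG GC] : is_cone G /\ G `<=` C by case: fG.
have [e [r [Ge r0 er]]] := face_interior_ball fG.
suff Fe : F e.
  move=> z Gz; pose t := r / (2 * (`|z| + 1)).
  have t0 : 0 < t by rewrite divr_gt0 // mulr_gt0 // ltr_wpDl.
  have tz : `|- (t *: z)| < r.
    rewrite normrN normrZ gtr0_norm // /t mulrAC ltr_pdivrMr ?mulr_gt0 ?ltr_wpDl//.
    by rewrite ltr_pM2l //; have := normr_ge0 z; lra.
  have Ftz : F (t *: z).
    apply: (face_le fF) Fe; first by apply: coneZ (ltW t0) _ => //; exact: GC.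
    apply: GC; apply: er tz; rewrite -scaleN1r.
    by do 2!apply: lin_spanZ; exact: lin_span_sub.
  rewrite -[z](scalerK (lt0r_neq0 t0)).
  by apply: coneZ => //; rewrite invr_ge0 ltW.
apply: contrapT => nFe.
pose A : set (H * R) :=
  [set p | exists g v, [/\ G g, F v & p = (g - v + e, 0)]].
have [||||w [s [q [q0 Aq Aw]]]] := @separation_from_zero _ _ _ hH A ((r / 2) ^+ 2).
- by exists (e - 0 + e, 0), e, 0; split=> //; exact: cF.1.
- move=> _ _ _ _ t /andP[t0 t1] [g [v [Gg Fv [-> ->]]]] [g' [v' [Gg' Fv' [-> ->]]]].
  exists (t *: g + (1 - t) *: g'), (t *: v + (1 - t) *: v'); split.
  + by apply: cG.2 => //; rewrite subr_ge0.
  + by apply: cF.2 => //; rewrite subr_ge0.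
  + rewrite !mulr0 addr0; congr (_, _).
    by apply: (ip_injl hH) => z; rewrite !ipE; ring.
- by rewrite exprn_gt0 // divr_gt0.
- move=> _ _ [g [v [Gg Fv [-> ->]]]]; rewrite expr0n /= addr0.
  rewrite leNgt; apply/negP; rewrite ltr_pXn2r ?nnegrE ?normr_ge0 ?divr_ge0 ?ltW//.
  move=> small; apply: nFe.
  have Ge2u : G (e + 2 *: (v - g - e)).
    apply: er.
      apply/lin_spanZ/lin_spanB; last exact: lin_span_sub.
      by apply: lin_spanB; apply: lin_span_sub => //; exact: FG.
    rewrite normrZ ger0_norm // mulrC -ltr_pdivlMr //.
    by rewrite -normrN !opprD !opprK [- v + g]addrC.
  have -> : e = 2 *: (2^-1 *: e) by rewrite scalerA divff ?scale1r.
  apply: coneZ => //; apply: (face_le fF _ _ Fv).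
    by apply: coneZ; rewrite ?invr_ge0 //; exact: GC.
  have -> : v - 2^-1 *: e = g + 2^-1 *: (e + 2 *: (v - g - e)).
    by apply: (ip_injl hH) => z; rewrite !ipE; field.
  by apply: GC; apply: coneD => //; apply: coneZ; rewrite ?invr_ge0.
have Aq' g v : G g -> F v -> q <= ip w (g - v + e).
  move=> Gg Fv; have /Aq : A (g - v + e, 0) by exists g, v.
  by rewrite mulr0 addr0.
have wG g : G g -> 0 <= ip w g.
  move=> Gg; apply: (@slope_ge0 _ _ (ip w e) q) => t t0.
  have := Aq' _ _ (coneZ cG t0 Gg) cF.1.
  by rewrite subr0 ipDr ipZr.
have wF v : F v -> ip w v <= 0.
  move=> Fv; rewrite -oppr_ge0 -ipNr; apply: (@slope_ge0 _ _ (ip w e) q) => t t0.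
  have := Aq' _ _ cG.1 (coneZ cF t0 Fv).
  by rewrite sub0r -scalerN ipDr ipZr.
have Gw : G w.
  rewrite -(face_dual fG); split=> //.
  apply: closure_lin_span Aw => _ [_ [g [v [Gg Fv ->]]] <-] /=.
  apply: lin_spanD; last exact: lin_span_sub.
  by apply: lin_spanB; apply: lin_span_sub => //; exact: FG.
have w0 : w = 0.
  apply/eqP; rewrite -normr_eq0 -sqrf_eq0 -hH; apply/eqP; apply: Gw.2 => [|v Fv].
    exact: GC.
  by apply/eqP; rewrite eq_le wF // wG //; exact: FG.
have := Aq' _ _ Ge cF.1; rewrite w0 ip0l; lra.
Qed.
End Faces.

(** * The effective domain *)

Section NondecreasingFunctions.
Context (R : realType) (H : completeNormedModType R) (ip : {dot H for idfun}).
Hypothesis hH : hilbert_inner ip.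
Context (C : set H).
Hypothesis hC : perfect_cone ip C.
Context (f : H -> \bar R).
Hypothesis hf : Gamma_nondecr C f.
Implicit Types (x y z : H) (a b r : R).
Let cC := perfect_is_cone hC.

Lemma Gamma_le x y : C y -> C (x - y) -> (f y <= f x)%E.
Proof. by move=> Cy Cxy; case: hf => _ _ _ _; apply=> //; rewrite /cone_le subr0. Qed.

Lemma Gamma_convex t x y a b : 0 <= t <= 1 -> C x -> C y ->
  (f x <= a%:E)%E -> (f y <= b%:E)%E ->
  (f (t *: x + (1 - t) *: y)%R <= (t * a + (1 - t) * b)%R%:E)%E.
Proof.
move=> t01 Cx Cy fx fy; case: hf => _ _ cvx _ _.
apply: (le_trans (cvx t x y t01 Cx Cy)).
have /andP[t0 t1] := t01.
rewrite [leRHS]EFinD !EFinM; apply: leeD; apply: lee_wpmul2l => //.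
by rewrite lee_fin subr_ge0.
Qed.

Lemma Gamma_at0 : exists m : R, f 0 = m%:E.
Proof.
case: hf => noo [x Cx fx] _ _ _; have := noo 0 cC.1.
have : (f 0%R <= f x)%E by apply: Gamma_le; rewrite ?subr0 //; exact: cC.1.
case: (f 0) => [m| |] //; first by exists m.
by rewrite leye_eq => /eqP.
Qed.

Lemma Gamma_ge0 x : C x -> (f 0%R <= f x)%E.
Proof. by move=> Cx; apply: Gamma_le; rewrite ?subr0 //; exact: cC.1. Qed.

(** The cone generated by the effective domain, with the scalar on the side of
    the domain so that it is visibly a set of points of [C]. *)
Definition domain_cone : set H :=
  [set x | C x /\ exists2 t : R, 0 < t & exists a : R, (f (t *: x)%R <= a%:E)%E].

Lemma domain_coneW x a : C x -> (f x <= a%:E)%E -> domain_cone x.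
Proof. by move=> Cx fx; split=> //; exists 1 => //; exists a; rewrite scale1r. Qed.

(** The effective domain is convex and closed under taking smaller points of
    [C], so finitely many of its rays can be rescaled by one common factor. *)
Lemma domain_cone_face : is_face C domain_cone.
Proof.
have shrink x t s a : C x -> 0 <= s <= t -> (f (t *: x)%R <= a%:E)%E ->
    (f (s *: x)%R <= a%:E)%E.
  move=> Cx /andP[s0 st]; apply: le_trans; apply: Gamma_le.
    exact: coneZ.
  by rewrite -scalerBl; apply: coneZ; rewrite ?subr_ge0.
have [m fm] := Gamma_at0.
split; first by move=> x [].
  split; first by apply: (@domain_coneW 0 m); rewrite ?fm //; exact: cC.1.
  move=> a b x y a0 b0 [Cx [t t0 [u fx]]] [Cy [s s0 [v fy]]].
  split; first exact: cC.2.
  pose k := Num.min t s.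
  have k0 : 0 < k by rewrite lt_min t0.
  have fkx : (f (k *: x)%R <= u%:E)%E.
    by apply: (shrink _ t) fx => //; rewrite (ltW k0) ge_min lexx.
  have fky : (f (k *: y)%R <= v%:E)%E.
    by apply: (shrink _ s) fy => //; rewrite (ltW k0) ge_min lexx orbT.
  have [ab0|ab0] := eqVneq (a + b) 0.
    have [-> ->] : a = 0 /\ b = 0 by lra.
    by exists 1 => //; exists m; rewrite !scale0r addr0 scaler0 fm.
  have ab : 0 < a + b by rewrite lt_neqAle eq_sym ab0 addr_ge0.
  exists (k / (a + b)); first exact: divr_gt0.
  pose lam := a / (a + b).
  have lam01 : 0 <= lam <= 1.
    by rewrite /lam divr_ge0 ?(ltW ab) //= ler_pdivrMr // mul1r lerDl.
  exists (lam * u + (1 - lam) * v).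
  have -> : (k / (a + b)) *: (a *: x + b *: y) =
      lam *: (k *: x) + (1 - lam) *: (k *: y).
    by apply: (ip_injl hH) => z; rewrite !ipE /lam; field.
  by apply: Gamma_convex => //; apply: coneZ (ltW k0) _.
move=> x y; rewrite /cone_le subr0 => Cx Cyx [Cy [t t0 [a fy]]].
split=> //; exists t => //; exists a; apply: le_trans fy; apply: Gamma_le.
  exact: coneZ (ltW t0) Cx.
by rewrite -scalerBr; exact: coneZ (ltW t0) Cyx.
Qed.

(** The distance from [(x, a)] to the points [(c - u, r)] is positive. Write
    [c - u = x + v] with [v] small. Moving by a proportion [s] towards a
    relative interior point [e] of the face at which [f] is finite turns
    [x + v] into a point [z] of the face, although [x + v] itself may fail to
    lie in [C]. Then [z] is below [s *: e + (1 - s) *: c], so [f z] is hardly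
    larger than [a], against lower semicontinuity at [x]. *)
Lemma epigraph_gap x a : domain_cone x -> (a%:E < f x)%E ->
  exists2 d : R, 0 < d & forall c u r, C c -> domain_cone u ->
    (f c <= r%:E)%E -> d <= `|u + x - c| ^+ 2 + (r - a) ^+ 2.
Proof.
move=> Fx afx; have fF := domain_cone_face; have [FC cF _] := fF.
have Cx := FC _ Fx.
have [b ab bfx] : exists2 b, a < b & (b%:E < f x)%E.
  case: (f x) afx => [v| |] //; last by exists (a + 1); rewrite ?ltry // ltrDl.
  by rewrite lte_fin => av; exists ((a + v) / 2); rewrite ?lte_fin; lra.
have [eta eta0 lsc] : exists2 eta : R, 0 < eta &
    forall y, C y -> `|y - x| < eta -> (b%:E < f y)%E.
  have [_ _ _ lscf _] := hf; have [V] := lscf x b bfx.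
  move=> nV bV.
  have [W /nbhs_ballP[eta /= eta0 etaW] VW] := (@nbhs_subspace_ex H C V x Cx).1 nV.
  exists eta => // y Cy yx; apply: bV.
  suff : (V `&` C) y by case.
  by rewrite VW; split=> //; apply: etaW; rewrite -ball_normE /= distrC.
have [e0 [rho0 [Fe0 rho00 ball0]]] := face_interior_ball hC fF.
have [_ [t t0 [M fM]]] := Fe0.
pose e := t *: e0; pose rho := t * rho0.
have rho_gt0 : 0 < rho by exact: mulr_gt0.
have balle v : lin_span domain_cone v -> `|v| < rho -> domain_cone (e + v).
  move=> sv vr; rewrite -[v](scalerKV (lt0r_neq0 t0)) -scalerDr.
  apply: coneZ (ltW t0) _ => //; apply: ball0; first exact: lin_spanZ.
  by rewrite normrZ gtr0_norm ?invr_gt0 // mulrC ltr_pdivrMr // mulrC.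
have ba : 0 < b - a by rewrite subr_gt0.
(* [s] is small enough that moving [x] by [s *: (e - x)] and [a] by
   [s * (M - a)] uses at most half of the room given by [eta] and [b - a]. *)
pose s := Num.min 2^-1
  (Num.min (eta / (2 * (`|e - x| + 1))) ((b - a) / (2 * (`|M - a| + 1)))).
have p1 : 0 < 2 * (`|e - x| + 1) by have := normr_ge0 (e - x); lra.
have p2 : 0 < 2 * (`|M - a| + 1) by have := normr_ge0 (M - a); lra.
have s0 : 0 < s by rewrite !lt_min invr_gt0 ltr0n !divr_gt0.
have s1 : s <= 2^-1 by rewrite ge_min lexx.
have s2 : s * (2 * (`|e - x| + 1)) <= eta.
  by rewrite -ler_pdivlMr // !ge_min lexx !orbT.
have s3 : s * (2 * (`|M - a| + 1)) <= b - a.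
  by rewrite -ler_pdivlMr // !ge_min lexx !orbT.
(* The bound [s * rho] lets the ball around [e], shrunk by [s], absorb [v]. *)
pose eps := Num.min (s * rho) (Num.min (eta / 2) ((b - a) / 2)).
have eps0 : 0 < eps by rewrite !lt_min mulr_gt0 //= !divr_gt0.
have eps1 : eps <= s * rho by rewrite ge_min lexx.
have eps2 : eps <= eta / 2 by rewrite !ge_min lexx !orbT.
have eps3 : eps <= (b - a) / 2 by rewrite !ge_min lexx !orbT.
exists (eps ^+ 2); first exact: exprn_gt0.
move=> c u r Cc Fu fc; rewrite leNgt; apply/negP => close.
pose v := c - u - x.
have vE : `|u + x - c| = `|v|.
  rewrite -normrN; congr `|_|.
  by apply: (ip_injl hH) => y; rewrite /v !ipE; ring.
have v_lt : `|v| < eps.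
  rewrite -(@ltr_pXn2r _ 2) ?nnegrE ?normr_ge0 ?(ltW eps0) // -vE.
  by apply: le_lt_trans close; rewrite lerDl sqr_ge0.
have r_lt : `|r - a| < eps.
  rewrite -(@ltr_pXn2r _ 2) ?nnegrE ?normr_ge0 ?(ltW eps0) //.
  rewrite real_normK ?num_real //.
  by apply: le_lt_trans close; rewrite lerDr sqr_ge0.
pose z := s *: e + (1 - s) *: (c - u).
have Fc : domain_cone c by exact: domain_coneW fc.
have Fz : domain_cone z.
  have -> : z = (1 - s) *: x + s *: (e + ((1 - s) / s) *: v).
    apply: (ip_injl hH) => y; rewrite /z /v !ipE; field.
    by rewrite gt_eqF.
  apply: coneD => //; apply: coneZ => //; first lra.
    exact: ltW.
  apply: balle.
    by apply/lin_spanZ/lin_spanB; [apply: lin_spanB|]; exact: lin_span_sub.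
  rewrite normrZ ger0_norm ?divr_ge0 ?(ltW s0) //; last lra.
  rewrite mulrAC ltr_pdivrMr //.
  apply: (@le_lt_trans _ _ (1 * `|v|)).
    by apply: ler_wpM2r => //; lra.
  by rewrite mul1r mulrC; exact: lt_le_trans eps1.
have fz : (f z <= (s * M + (1 - s) * r)%:E)%E.
  apply: (@le_trans _ _ (f (s *: e + (1 - s) *: c)%R)); last first.
    apply: Gamma_convex => //; first lra.
    exact: coneZ (ltW t0) (FC _ Fe0).
  apply: Gamma_le; first exact: FC.
  have -> : s *: e + (1 - s) *: c - z = (1 - s) *: u.
    by apply: (ip_injl hH) => y; rewrite /z !ipE; ring.
  by apply: coneZ; [|lra|exact: FC].
have zx : `|z - x| < eta.
  have -> : z - x = (1 - s) *: v + s *: (e - x).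
    by apply: (ip_injl hH) => y; rewrite /z /v !ipE; ring.
  apply: (le_lt_trans (ler_normD _ _)); rewrite !normrZ.
  rewrite (ger0_norm (ltW s0)) ger0_norm; last lra.
  have : (1 - s) * `|v| <= 1 * `|v| by apply: ler_wpM2r => //; lra.
  lra.
have := lt_le_trans (lsc _ (FC _ Fz) zx) fz; rewrite lte_fin.
have : (1 - s) * (r - a) <= 1 * `|r - a|.
  apply: (@le_trans _ _ ((1 - s) * `|r - a|)).
    by apply: ler_wpM2l; [lra|exact: ler_norm].
  by apply: ler_wpM2r => //; lra.
have : s * (M - a) <= s * `|M - a| by rewrite ler_wpM2l ?ler_norm // ltW.
lra.
Qed.

(** A functional that is nonpositive on the effective domain and positive at
    [x] can be added, with any nonnegative factor, to the constant [f 0]. *)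
Lemma affine_minorant_steepen y b0 x a : C y ->
    (forall c r, C c -> f c = r%:E -> ip y c + b0 <= 0) -> 0 < ip y x + b0 ->
  exists y' b, [/\ C y', forall c r, C c -> f c = r%:E -> ip y' c + b <= r &
    a <= ip y' x + b].
Proof.
move=> Cy yD yx; have [m fm] := Gamma_at0.
pose t := `|a - m| / (ip y x + b0).
have t0 : 0 <= t by rewrite divr_ge0 // ltW.
exists (t *: y), (t * b0 + m); split; first exact: coneZ.
  move=> c r Cc fc; have := Gamma_ge0 Cc; rewrite fm fc lee_fin ipZl => mr.
  by have := ler_wpM2l t0 (yD _ _ Cc fc); rewrite mulrDr mulr0; lra.
rewrite ipZl addrA -mulrDr divfK ?gt_eqF //.
by have := ler_norm (a - m); lra.
Qed.

Lemma affine_minorant_above x a : C x -> (a%:E < f x)%E ->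
  exists y b, [/\ C y, forall c r, C c -> f c = r%:E -> ip y c + b <= r &
    a <= ip y x + b].
Proof.
move=> Cx afx; have fF := domain_cone_face; have [FC cF _] := fF.
have [Fx|nFx] := pselect (domain_cone x); last first.
  have [y [Cy yF yx]] := separation_from_face hH hC fF Cx nFx.
  apply: (@affine_minorant_steepen y 0) => //; rewrite ?addr0 // => c r Cc fc.
  by rewrite addr0 yF //; apply: (@domain_coneW _ r) => //; rewrite fc.
have [d d0 gap] := epigraph_gap Fx afx.
(* The set is reflected in its first component so that the separating vector
   [w] itself, rather than [- w], is the slope. *)
pose A : set (H * R) := [set p | exists c u r,
  [/\ C c, domain_cone u, (f c <= r%:E)%E & p = (u + x - c, r - a)]].
have [m fm] := Gamma_at0.
have [|||w [s [q [q0 Aq Aw]]]] := @separation_from_zero _ _ _ hH A d _ _ d0.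
- exists (0 + x - 0, m - a), 0, 0, m.
  by split=> //; [exact: cC.1|exact: cF.1|rewrite fm].
- move=> _ _ _ _ t t01 [c [u [r [Cc Fu fc [-> ->]]]]]
    [c' [u' [r' [Cc' Fu' fc' [-> ->]]]]].
  have /andP[t0 t1] := t01; have t1' : 0 <= 1 - t by rewrite subr_ge0.
  exists (t *: c + (1 - t) *: c'), (t *: u + (1 - t) *: u'),
    (t * r + (1 - t) * r'); split.
  + exact: cC.2.
  + exact: cF.2.
  + exact: Gamma_convex.
  + congr (_, _); last by ring.
    by apply: (ip_injl hH) => z; rewrite !ipE; ring.
- by move=> _ _ [c [u [r [Cc Fu fc [-> ->]]]]]; exact: gap.
have Aq' c u r : C c -> domain_cone u -> (f c <= r%:E)%E ->
    q <= ip w (u + x - c) + s * (r - a).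
  by move=> Cc Fu fc; apply: Aq; exists c, u, r.
have s0 : 0 <= s.
  apply: (@slope_ge0 _ _ (ip w (0 + x - 0) + s * (m - a)) q) => t t0.
  have := Aq' 0 0 (m + t) cC.1 cF.1; rewrite fm lee_fin lerDl => /(_ t0).
  lra.
have Fw : domain_cone w.
  rewrite -(face_dual hC fF); split.
    apply: closure_lin_span Aw => _ [_ [c [u [r [Cc Fu fc ->]]]] <-] /=.
    apply: lin_spanB; last exact/lin_span_sub/(domain_coneW Cc fc).
    by apply: lin_spanD; exact: lin_span_sub.
  move=> u Fu.
  apply: (@slope_ge0 _ _ (ip w (x - 0) + s * (m - a)) q) => t t0.
  have := Aq' 0 (t *: u) m cC.1 (coneZ cF t0 Fu); rewrite fm => /(_ (lexx _)).
  by rewrite !ipE; lra.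
have key c r : C c -> f c = r%:E -> q <= ip w x - ip w c + s * (r - a).
  move=> Cc fc; have := Aq' c 0 r Cc cF.1; rewrite fc => /(_ (lexx _)).
  by rewrite add0r !ipE.
(* [s = 0] is the case of a vertical hyperplane. *)
have [s00|s_neq0] := eqVneq s 0.
  apply: (@affine_minorant_steepen w (q - ip w x)); first exact: FC.
    by move=> c r Cc fc; have := key c r Cc fc; rewrite s00 mul0r; lra.
  lra.
have s_gt0 : 0 < s by rewrite lt_neqAle eq_sym s_neq0.
exists (s^-1 *: w), (a - s^-1 * ip w x); split.
- by apply: coneZ; rewrite ?invr_ge0 //; exact: FC.
- move=> c r Cc fc; rewrite -(ler_pM2l s_gt0) ipZl mulrDr mulrBr !mulVKf //.
  by have := key c r Cc fc; lra.
- by rewrite ipZl; lra.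
Qed.

End NondecreasingFunctions.

(** * Monotone biconjugates *)

Section Biconjugate.
Context (R : realType) (H : completeNormedModType R) (ip : {dot H for idfun}).
Context (C : set H) (f : H -> \bar R).
Hypothesis dualC : dual_cone ip C = C.
Hypothesis hf : into_ninfty_free C f.
Implicit Types (x y z : H) (a b r : R).

Lemma affine_minorant_le_biconjugate y b x : C y ->
    (forall c r, C c -> f c = r%:E -> ip y c + b <= r) ->
  ((ip y x + b)%:E <= monotone_biconjugate ip C f x)%E.
Proof.
move=> Cy yb.
have fy : (monotone_conjugate ip C f y <= (- b)%:E)%E.
  apply: ge_ereal_sup => _ [c Cc <-].
  have := hf Cc; case fc : (f c) => [r| |] // _.
    rewrite -EFinB lee_fin; have := yb c r Cc fc; rewrite (ipC ip); lra.
  by rewrite addeNy leNye.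
apply: (@le_trans _ _ ((ip y x)%:E - monotone_conjugate ip C f y)%E).
  by rewrite EFinD leeD2l // leeNr.
by apply: ereal_sup_ubound; exists y => //; rewrite dualC.
Qed.

Lemma conjugate_affine_le y x : C x ->
  ((ip y x)%:E - monotone_conjugate ip C f y <= f x)%E.
Proof.
move=> Cx; have : ((ip x y)%:E - f x <= monotone_conjugate ip C f y)%E.
  by apply: ereal_sup_ubound; exists x.
have := hf Cx; case: (f x) => [r| |] // _; last by rewrite leey.
case: (monotone_conjugate _ _ _ _) => [b| |] //.
  by rewrite -!EFinB !lee_fin (ipC ip x); lra.
by rewrite addeNy leNye.
Qed.

Lemma biconjugate_le x : C x -> (monotone_biconjugate ip C f x <= f x)%E.
Proof. by move=> Cx; apply: ge_ereal_sup => _ [y _ <-]; exact: conjugate_affine_le. Qed.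

Hypothesis hH : hilbert_inner ip.
Hypothesis cC : is_cone C.
Hypothesis fproper : proper_on C f.
Hypothesis fE : forall x, C x -> f x = monotone_biconjugate ip C f x.

Lemma conjugate_gtNy y : (-oo < monotone_conjugate ip C f y)%E.
Proof.
have [x Cx fx] := fproper.
have : ((ip x y)%:E - f x <= monotone_conjugate ip C f y)%E.
  by apply: ereal_sup_ubound; exists x.
by have := hf Cx; case: (f x) fx => // r _ _; apply: lt_le_trans; rewrite ltNyr.
Qed.

Lemma biconjugate_fixpoint_convex : convex_on C f.
Proof.
move=> t x y /andP[t0 t1] Cx Cy.
have t1' : 0 <= 1 - t by rewrite subr_ge0.
rewrite (fE (cC.2 _ _ _ _ t0 t1' Cx Cy)).
apply: ge_ereal_sup => _ [w _ <-].
have := conjugate_gtNy w; have := conjugate_affine_le w Cy.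
have := conjugate_affine_le w Cx.
case: (monotone_conjugate ip C f w) => [b| |] // hx hy _; last first.
  by rewrite addeNy leNye.
have := leeD (lee_wpmul2l _ hx) (lee_wpmul2l _ hy).
move=> /(_ t%:E (1 - t)%:E t0 t1'); apply: le_trans.
rewrite -!EFinB -!EFinM -EFinD lee_fin !ipE.
lra.
Qed.

Lemma biconjugate_fixpoint_lsc : lsc_on C f.
Proof.
move=> x a afx.
have [Cx|nCx] := pselect (C x); last first.
  exists [set x]; last by move=> _ ->.
  by case: (nbhs_subspaceP C x) => // _ y ->.
move: afx; rewrite /from_subspace (fE Cx) => /ereal_sup_gt[_ [w Cw <-]].
have := conjugate_gtNy w.
case fw : (monotone_conjugate ip C f w) => [b| |] // _.
rewrite -EFinB lte_fin => awx.
pose e := (ip w x - b - a) / (`|w| + 1).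
have w1 : 0 < `|w| + 1 by rewrite ltr_wpDl.
have e0 : 0 < e by rewrite divr_gt0 //; lra.
exists (ball (x : H) e `&` C).
  apply/(@nbhs_subspace_ex H C _ x Cx).
  exists (ball (x : H) e); first exact: nbhsx_ballx.
  by rewrite -setIA setIid.
move=> y [+ Cy]; rewrite -ball_normE /= => xy.
apply: lt_le_trans (conjugate_affine_le w Cy); rewrite fw -EFinB lte_fin.
have := le_trans (ler_norm _) (cauchy_schwarz hH w (x - y)).
have : `|w| * `|x - y| <= (`|w| + 1) * `|x - y|.
  by apply: ler_wpM2r => //; rewrite lerDl.
have : (`|w| + 1) * `|x - y| < ip w x - b - a by rewrite mulrC -ltr_pdivlMr.
rewrite !ipE; lra.
Qed.

Lemma biconjugate_fixpoint_nondecreasing : cone_nondecreasing C f.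
Proof.
move=> x y; rewrite /cone_le subr0 => Cxy Cy.
have Cx : C x by rewrite -[x](subrK y); exact: coneD.
rewrite (fE Cy); apply: ge_ereal_sup => _ [w Cw <-].
apply: le_trans (conjugate_affine_le w Cx).
apply: leeD2r; rewrite lee_fin -subr_ge0 -ipNr -ipDr.
by move: Cw => [_]; apply.
Qed.

End Biconjugate.

(** * The biconjugation theorem *)

Theorem corollary2p3 (R : realType) (H : completeNormedModType R)
    (ip : {dot H for idfun}%R) (hH : hilbert_inner ip)
    (C : set H) (hC : perfect_cone ip C)
    (f : H -> \bar R) (hf : into_ninfty_free C f) (fproper : proper_on C f) :
  (forall x : H, C x -> f x = monotone_biconjugate ip C f x) <->
  Gamma_nondecr C f.
Proof.
have cC := perfect_is_cone hC.
have dualC := face_dual hC (perfect_is_face hC).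
split=> [fE|fG x Cx].
  split=> //.
  - exact: biconjugate_fixpoint_convex fE.
  - exact: biconjugate_fixpoint_lsc fE.
  - exact: biconjugate_fixpoint_nondecreasing fE.
apply/eqP; rewrite eq_le biconjugate_le // andbT leNgt; apply/negP => lt.
have above a : (a%:E < f x)%E -> (a%:E <= monotone_biconjugate ip C f x)%E.
  move=> /(affine_minorant_above hH hC fG Cx)[y [b [Cy yb ax]]].
  apply: le_trans (affine_minorant_le_biconjugate dualC hf x Cy yb).
  by rewrite lee_fin.
case: (f x) lt above => [u| |]; case: monotone_biconjugate => [v| |] //= lt above.
- by have := above ((u + v) / 2); move: lt; rewrite !lte_fin !lee_fin; lra.
- by have := above (u - 1); rewrite lte_fin leeNy_eq ltrBlDr ltrDl => /(_ ltr01).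
- by have := above (v + 1); rewrite ltry lee_fin gerDl ler10 => /(_ isT).
- by have := above 0; rewrite ltry => /(_ isT).
Qed.
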